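(* Let $\mathsf{C}$ be a partializable Markov category and let $u\colon X\to Y$ be a morphism of $\mathsf{Partial}(\mathsf{C})$ represented by a span $(D,i,f)$. Then the span restriction $\bar u:=(D,i,i)\colon X\to X$ equals the CD-categorical domain $\mathrm{dom}(u)$ of $u$ in $\mathsf{Partial}(\mathsf{C})$. In particular, the assignment $u\mapsto\mathrm{dom}(u)$ defines a restriction structure on $\mathsf{Partial}(\mathsf{C})$.
   Context: A CD category is a symmetric monoidal category $(\mathsf{C},\otimes,I)$ in which every object $X$ carries a commutative comonoid structure $\mathrm{copy}_X\colon X\to X\otimes X$, $\mathrm{del}_X\colon X\to I$, compatible with tensor products ($\mathrm{copy}_{X\otimes Y}$ is $\mathrm{copy}_X\otimes\mathrm{copy}_Y$ followed by swapping the two middle factors, and $\mathrm{del}_{X\otimes Y}=\mathrm{del}_X\otimes\mathrm{del}_Y$) and with $\mathrm{copy}_I=\mathrm{del}_I=\mathrm{id}_I$; coherence isomorphisms are suppressed. A morphism $f\colon X\to Y$ is total if $\mathrm{del}_Y\circ f=\mathrm{del}_X$, copyable if $\mathrm{copy}_Y\circ f=(f\otimes f)\circ\mathrm{copy}_X$, and deterministic if it is both. The domain of $f$ is $\mathrm{dom}(f):=(\mathrm{id}_X\otimes(\mathrm{del}_Y\circ f))\circ\mathrm{copy}_X\colon X\to X$. A Markov category is a CD category in which every morphism is total. A Markov category is positive if for all $u\colon X\to Y$, $v\colon Y\to Z$ with $v\circ u$ deterministic, $(u\otimes (v\circ u))\circ\mathrm{copy}_X=(\mathrm{id}_Y\otimes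 v)\circ\mathrm{copy}_Y\circ u$. A Markov category $\mathsf{C}$ is partializable if: (i) it is positive; (ii) pullbacks of deterministic monomorphisms along arbitrary morphisms exist and are themselves deterministic (monomorphisms); (iii) if $i\colon D\to X$ is a deterministic monomorphism then $i\otimes\mathrm{id}_A$ is a monomorphism for every object $A$. For $\mathsf{C}$ partializable, the CD category $\mathsf{Partial}(\mathsf{C})$ has the objects of $\mathsf{C}$; its morphisms $X\to Y$ are equivalence classes of spans $X\xleftarrow{i}D\xrightarrow{f}Y$ (also written $(D,i,f)$) in $\mathsf{C}$ with $i$ a deterministic monomorphism, where $(D,i,f)\sim(D',i',f')$ iff there is an isomorphism $t\colon D\to D'$ with $i'\circ t=i$, $f'\circ t=f$. The composite of $(A,i,f)\colon X\to Y$ followed by $(B,j,g)\colon Y\to Z$ is $(C,i\circ u,g\circ v)$, where $A\xleftarrow{u}C\xrightarrow{v}B$ is the pullback of $f$ and $j$. The inclusion $\mathsf{C}\hookrightarrow\mathsf{Partial}(\mathsf{C})$ sends $f\colon X\to Y$ to $(X,\mathrm{id}_X,f)$. The tensor product is componentwise, $(A,i,f)\otimes(B,j,g)=(A\otimes B,i\otimes j,f\otimes g)$, and the copy and delete maps (and coherence isomorphisms) are the images of those of $\mathsf{C}$ under the inclusion. A restriction structure on a category is an assignment, to each morphism $f\colon X\to Y$, of an endomorphism $\bar f\colon X\to X$ such that: (R.1) $f\circ\bar f=f$; (R.2) $\bar f\circ\bar g=\bar g\circ\bar f$ whenever $f,g$ have the same source; (R.3) $\overline{g\circ\bar f}=\bar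 g\circ\bar f$ whenever $f,g$ have the same source; (R.4) $\bar g\circ f=f\circ\overline{g\circ f}$ whenever $g\circ f$ is defined. It is known that $(D,i,f)\mapsto(D,i,i)$ is a restriction structure on $\mathsf{Partial}(\mathsf{C})$. *)

(* Defs.v *)
From mathcomp Require Import all_boot generic_quotient.
From mathcomp Require Import boolp.

Set Implicit Arguments.
Unset Strict Implicit.
Unset Printing Implicit Defensive.

Declare Scope cat_scope.
Local Open Scope quotient_scope.
Local Open Scope cat_scope.

Reserved Notation "g ∘ f" (at level 40, left associativity).
Reserved Notation "X ⊗ Y" (at level 38, left associativity).
Reserved Notation "f ⊠ g" (at level 38, left associativity).

Structure category := Category {
  ob :> Type;
  hom : ob -> ob -> Type;
  idm : forall X, hom X X;
  compm : forall {X Y Z}, hom Y Z -> hom X Y -> hom X Z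
    where "g ∘ f" := (compm g f);
  comp1m : forall X Y (f : hom X Y), idm Y ∘ f = f;
  compm1 : forall X Y (f : hom X Y), f ∘ idm X = f;
  compmA : forall X Y Z W (h : hom Z W) (g : hom Y Z) (f : hom X Y),
    h ∘ (g ∘ f) = (h ∘ g) ∘ f
}.

Arguments hom {c} X Y.
Arguments idm {c} X.
Arguments compm {c X Y Z} g f.
Notation "g ∘ f" := (compm g f) : cat_scope.

Definition monic (C : category) (X Y : C) (i : hom X Y) : Prop :=
  forall (T : C) (a b : hom T X), i ∘ a = i ∘ b -> a = b.

Definition is_iso (C : category) (X Y : C) (t : hom X Y) : Prop :=
  exists s : hom Y X, s ∘ t = idm X /\ t ∘ s = idm Y.

Definition is_pullback (C : category) (X Y Z P : C)
    (f : hom X Z) (g : hom Y Z) (p : hom P X) (q : hom P Y) : Prop :=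
  f ∘ p = g ∘ q /\
  forall (T : C) (a : hom T X) (b : hom T Y), f ∘ a = g ∘ b ->
    exists! c : hom T P, p ∘ c = a /\ q ∘ c = b.

Structure restriction_structure (C : category)
    (r : forall X Y : C, hom X Y -> hom X X) : Prop := {
  restr1 : forall (X Y : C) (f : hom X Y), f ∘ r X Y f = f;
  restr2 : forall (X Y Z : C) (f : hom X Y) (g : hom X Z),
    r X Y f ∘ r X Z g = r X Z g ∘ r X Y f;
  restr3 : forall (X Y Z : C) (f : hom X Y) (g : hom X Z),
    r X Z (g ∘ r X Y f) = r X Z g ∘ r X Y f;
  restr4 : forall (X Y Z : C) (f : hom X Y) (g : hom Y Z),
    r Y Z g ∘ f = f ∘ r X Z (g ∘ f)
}.

(* [tens] is the tensor product of objects, [tensm] (infix ⊠) that of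
   morphisms. *)
Structure symmoncat := SymMonCat {
  sm_cat :> category;
  tens : sm_cat -> sm_cat -> sm_cat where "X ⊗ Y" := (tens X Y);
  munit : sm_cat;
  tensm : forall {X X' Y Y' : sm_cat},
    hom X X' -> hom Y Y' -> hom (X ⊗ Y) (X' ⊗ Y')
    where "f ⊠ g" := (tensm f g);
  tensm1 : forall X Y : sm_cat, idm X ⊠ idm Y = idm (X ⊗ Y);
  tensmM : forall (X X' X'' Y Y' Y'' : sm_cat)
      (f' : hom X' X'') (f : hom X X') (g' : hom Y' Y'') (g : hom Y Y'),
    (f' ∘ f) ⊠ (g' ∘ g) = (f' ⊠ g') ∘ (f ⊠ g);
  assoc : forall X Y Z : sm_cat, hom ((X ⊗ Y) ⊗ Z) (X ⊗ (Y ⊗ Z));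
  assocV : forall X Y Z : sm_cat, hom (X ⊗ (Y ⊗ Z)) ((X ⊗ Y) ⊗ Z);
  lunit : forall X : sm_cat, hom (munit ⊗ X) X;
  lunitV : forall X : sm_cat, hom X (munit ⊗ X);
  runit : forall X : sm_cat, hom (X ⊗ munit) X;
  runitV : forall X : sm_cat, hom X (X ⊗ munit);
  braid : forall X Y : sm_cat, hom (X ⊗ Y) (Y ⊗ X);
  assocK : forall X Y Z, assocV X Y Z ∘ assoc X Y Z = idm _;
  assocVK : forall X Y Z, assoc X Y Z ∘ assocV X Y Z = idm _;
  lunitK : forall X, lunitV X ∘ lunit X = idm _;
  lunitVK : forall X, lunit X ∘ lunitV X = idm _;
  runitK : forall X, runitV X ∘ runit X = idm _;
  runitVK : forall X, runit X ∘ runitV X = idm _;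
  braidK : forall X Y, braid Y X ∘ braid X Y = idm _;
  assoc_nat : forall (X X' Y Y' Z Z' : sm_cat)
      (f : hom X X') (g : hom Y Y') (h : hom Z Z'),
    assoc X' Y' Z' ∘ ((f ⊠ g) ⊠ h) = (f ⊠ (g ⊠ h)) ∘ assoc X Y Z;
  lunit_nat : forall (X X' : sm_cat) (f : hom X X'),
    lunit X' ∘ (idm munit ⊠ f) = f ∘ lunit X;
  runit_nat : forall (X X' : sm_cat) (f : hom X X'),
    runit X' ∘ (f ⊠ idm munit) = f ∘ runit X;
  braid_nat : forall (X X' Y Y' : sm_cat) (f : hom X X') (g : hom Y Y'),
    braid X' Y' ∘ (f ⊠ g) = (g ⊠ f) ∘ braid X Y;
  pentagon : forall X Y Z W : sm_cat,
    (idm X ⊠ assoc Y Z W) ∘ assoc X (Y ⊗ Z) W ∘ (assoc X Y Z ⊠ idm W)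
    = assoc X Y (Z ⊗ W) ∘ assoc (X ⊗ Y) Z W;
  triangle : forall X Y : sm_cat,
    (idm X ⊠ lunit Y) ∘ assoc X munit Y = runit X ⊠ idm Y;
  hexagon : forall X Y Z : sm_cat,
    assoc Y Z X ∘ braid X (Y ⊗ Z) ∘ assoc X Y Z
    = (idm Y ⊠ braid X Z) ∘ assoc Y X Z ∘ (braid X Y ⊠ idm Z)
}.

Arguments tens {s} X Y.
Arguments munit {s}.
Arguments tensm {s X X' Y Y'} f g.
Arguments assoc {s} X Y Z.
Arguments assocV {s} X Y Z.
Arguments lunit {s} X.
Arguments lunitV {s} X.
Arguments runit {s} X.
Arguments runitV {s} X.
Arguments braid {s} X Y.
Notation "X ⊗ Y" := (tens X Y) : cat_scope.
Notation "f ⊠ g" := (tensm f g) : cat_scope.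

Definition swap_mid (C : symmoncat) (A B A' B' : C) :
    hom ((A ⊗ B) ⊗ (A' ⊗ B')) ((A ⊗ A') ⊗ (B ⊗ B')) :=
  assocV A A' (B ⊗ B')
  ∘ (idm A ⊠ (assoc A' B B' ∘ (braid B A' ⊠ idm B') ∘ assocV B A' B'))
  ∘ assoc A B (A' ⊗ B').

Structure cdcat := CDCat {
  cd_sm :> symmoncat;
  copy : forall X : cd_sm, hom X (X ⊗ X);
  del : forall X : cd_sm, hom X munit;
  copyA : forall X : cd_sm,
    assoc X X X ∘ (copy X ⊠ idm X) ∘ copy X = (idm X ⊠ copy X) ∘ copy X;
  copyC : forall X : cd_sm, braid X X ∘ copy X = copy X;
  copy_dell : forall X : cd_sm,
    lunit X ∘ (del X ⊠ idm X) ∘ copy X = idm X;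
  copy_delr : forall X : cd_sm,
    runit X ∘ (idm X ⊠ del X) ∘ copy X = idm X;
  copy_tens : forall X Y : cd_sm,
    copy (X ⊗ Y) = swap_mid X X Y Y ∘ (copy X ⊠ copy Y);
  del_tens : forall X Y : cd_sm,
    del (X ⊗ Y) = lunit munit ∘ (del X ⊠ del Y);
  copy_unit : copy munit = lunitV munit;
  del_unit : del munit = idm munit
}.

Arguments copy {c} X.
Arguments del {c} X.

Section CDNotions.
Variable C : cdcat.

Definition is_total (X Y : C) (f : hom X Y) : Prop := del Y ∘ f = del X.

Definition copyable (X Y : C) (f : hom X Y) : Prop :=
  copy Y ∘ f = (f ⊠ f) ∘ copy X.

Definition deterministic (X Y : C) (f : hom X Y) : Prop :=
  is_total f /\ copyable f.

Definition det_mono (X Y : C) (f : hom X Y) : Prop :=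
  deterministic f /\ monic f.

(* The coherence isomorphism X ⊗ I -> X, usually suppressed, is [runit]. *)
Definition dom (X Y : C) (f : hom X Y) : hom X X :=
  runit X ∘ (idm X ⊠ (del Y ∘ f)) ∘ copy X.

End CDNotions.

Structure markovcat := MarkovCat {
  mk_cd :> cdcat;
  all_total : forall (X Y : mk_cd) (f : hom X Y), is_total f
}.

Definition positive (C : markovcat) : Prop :=
  forall (X Y Z : C) (u : hom X Y) (v : hom Y Z), deterministic (v ∘ u) ->
    (u ⊠ (v ∘ u)) ∘ copy X = (idm Y ⊠ v) ∘ copy Y ∘ u.

(* "Pullbacks of deterministic monomorphisms exist and are themselves
   deterministic monomorphisms": [pz_pullback] and [pz_pullback_det]. The
   latter constrains the leg [p] parallel to [i], for every pullback. *)
Structure partializable (C : markovcat) : Prop := {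
  pz_positive : positive C;
  pz_pullback : forall (X Y D : C) (f : hom X Y) (i : hom D Y), det_mono i ->
    exists (P : C) (p : hom P X) (q : hom P D), is_pullback f i p q;
  pz_pullback_det : forall (X Y D P : C) (f : hom X Y) (i : hom D Y)
      (p : hom P X) (q : hom P D),
    det_mono i -> is_pullback f i p q -> det_mono p;
  pz_tens_monic : forall (D X A : C) (i : hom D X),
    det_mono i -> monic (i ⊠ idm A)
}.

Section CategoryFacts.
Variable C : category.

Lemma monic_comp (X Y Z : C) (g : hom Y Z) (f : hom X Y) :
  monic g -> monic f -> monic (g ∘ f).
Proof. by move=> mg mf T a b; rewrite -!compmA => /mg /mf. Qed.

Lemma monic_id (X : C) : monic (idm X).
Proof. by move=> T a b; rewrite !comp1m. Qed.

Lemma is_iso_id (X : C) : is_iso (idm X).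
Proof. by exists (idm X); rewrite comp1m. Qed.

Lemma pullback_id (X Y : C) (f : hom X Y) :
  is_pullback f (idm Y) (idm X) f.
Proof.
split=> [|T a b]; first by rewrite compm1 comp1m.
rewrite comp1m => <-; exists a; split; first by rewrite comp1m.
by move=> c [<- _]; rewrite comp1m.
Qed.

Lemma pullback_iso (X X' D D' : C) (h : hom X X') (k : hom D D')
    (i : hom D X) (j : hom D' X') :
  is_iso h -> is_iso k -> h ∘ i = j ∘ k -> monic j -> is_pullback h j i k.
Proof.
move=> [h' [h'K hK]] [k' [k'K kK]] e mj; split=> // T a b eab.
have ek : k ∘ (k' ∘ b) = b by rewrite compmA kK comp1m.
exists (k' ∘ b); split.
  split=> //; have : h ∘ (i ∘ (k' ∘ b)) = h ∘ a by rewrite compmA e -compmA ek.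
  by move/(congr1 (compm h')); rewrite !(compmA h') h'K !comp1m.
by move=> c [_ <-]; rewrite compmA k'K comp1m.
Qed.

Lemma pullback_sym (X Y Z P : C) (f : hom X Z) (g : hom Y Z)
    (p : hom P X) (q : hom P Y) :
  is_pullback f g p q -> is_pullback g f q p.
Proof.
move=> [e u]; split=> // T a b /esym /u[c [[pc qc] cu]].
by exists c; split=> // d [qd pd]; apply: cu.
Qed.

Lemma pullback_eq (X Y Z P : C) (f : hom X Z) (g : hom Y Z)
    (p : hom P X) (q : hom P Y) (T : C) (a b : hom T P) :
  is_pullback f g p q -> p ∘ a = p ∘ b -> q ∘ a = q ∘ b -> a = b.
Proof.
move=> [e u] pab qab.
have /u[c [_ cu]] : f ∘ (p ∘ a) = g ∘ (q ∘ a) by rewrite !compmA e.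
by rewrite -(cu a) // -(cu b).
Qed.

Lemma pullback_uniq (X Y Z P P' : C) (f : hom X Z) (g : hom Y Z)
    (p : hom P X) (q : hom P Y) (p' : hom P' X) (q' : hom P' Y) :
  is_pullback f g p q -> is_pullback f g p' q' ->
  exists t : hom P P', is_iso t /\ p' ∘ t = p /\ q' ∘ t = q.
Proof.
move=> pb pb'; have [e u] := pb; have [e' u'] := pb'.
have [t [[pt qt] _]] := u' _ _ _ e; have [s [[ps qs] _]] := u _ _ _ e'.
exists t; split=> //; exists s; split.
- by apply: (pullback_eq pb); rewrite compmA ?ps ?qs ?pt ?qt compm1.
- by apply: (pullback_eq pb'); rewrite compmA ?ps ?qs ?pt ?qt compm1.
Qed.

End CategoryFacts.

Section CDFacts.
Variable C : cdcat.

Lemma deterministic_id (X : C) : deterministic (idm X).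
Proof. by split; rewrite /is_total /copyable ?tensm1 compm1 ?comp1m. Qed.

Lemma deterministic_comp (X Y Z : C) (g : hom Y Z) (f : hom X Y) :
  deterministic g -> deterministic f -> deterministic (g ∘ f).
Proof.
move=> [tg cg] [tf cf]; split; rewrite /is_total /copyable compmA.
  by rewrite tg tf.
by rewrite cg -compmA cf compmA tensmM.
Qed.

Lemma det_mono_id (X : C) : det_mono (idm X).
Proof. by split; [exact: deterministic_id | exact: monic_id]. Qed.

Lemma det_mono_comp (X Y Z : C) (g : hom Y Z) (f : hom X Y) :
  det_mono g -> det_mono f -> det_mono (g ∘ f).
Proof.
by move=> [dg mg] [df mf]; split;
  [exact: deterministic_comp | exact: monic_comp].
Qed.

Lemma assoc_iso (X Y Z : C) : is_iso (assoc X Y Z).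
Proof. by exists (assocV X Y Z); rewrite assocK assocVK. Qed.

Lemma lunit_iso (X : C) : is_iso (lunit X).
Proof. by exists (lunitV X); rewrite lunitK lunitVK. Qed.

Lemma runit_iso (X : C) : is_iso (runit X).
Proof. by exists (runitV X); rewrite runitK runitVK. Qed.

Lemma braid_iso (X Y : C) : is_iso (braid X Y).
Proof. by exists (braid Y X); rewrite !braidK. Qed.

Lemma assocV_nat (X X' Y Y' Z Z' : C)
    (f : hom X X') (g : hom Y Y') (h : hom Z Z') :
  assocV X' Y' Z' ∘ (f ⊠ (g ⊠ h)) = ((f ⊠ g) ⊠ h) ∘ assocV X Y Z.
Proof.
rewrite -[LHS]compm1 -(assocVK X Y Z) compmA -(compmA (assocV _ _ _)).
by rewrite -assoc_nat compmA assocK comp1m.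
Qed.

Lemma swap_mid_nat (A1 A2 B1 B2 A1' A2' B1' B2' : C) (f : hom A1 A2)
    (g : hom B1 B2) (f' : hom A1' A2') (g' : hom B1' B2') :
  swap_mid A2 B2 A2' B2' ∘ ((f ⊠ g) ⊠ (f' ⊠ g'))
  = ((f ⊠ f') ⊠ (g ⊠ g')) ∘ swap_mid A1 B1 A1' B1'.
Proof.
have midE : assoc A2' B2 B2' ∘ (braid B2 A2' ⊠ idm B2') ∘ assocV B2 A2' B2'
      ∘ (g ⊠ (f' ⊠ g'))
    = (f' ⊠ (g ⊠ g'))
      ∘ (assoc A1' B1 B1' ∘ (braid B1 A1' ⊠ idm B1') ∘ assocV B1 A1' B1').
  rewrite -compmA assocV_nat !compmA -(compmA (assoc _ _ _)) -tensmM braid_nat.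
  by rewrite comp1m -{1}(compm1 g') tensmM compmA assoc_nat.
rewrite /swap_mid -compmA assoc_nat !compmA -(compmA (assocV _ _ _)) -tensmM midE.
by rewrite comp1m -{1}(compm1 f) tensmM compmA assocV_nat.
Qed.

Lemma braid_munit : braid munit munit = idm (munit ⊗ munit : C).
Proof.
have := copyC (munit : C); rewrite copy_unit => /(congr1 (fun h => h ∘ lunit _)).
by rewrite -compmA lunitK compm1.
Qed.

Lemma swap_mid_munit (A B : C) : swap_mid A munit munit B = idm _.
Proof.
rewrite /swap_mid braid_munit tensm1 compm1 assocVK tensm1 compm1.
exact: assocK.
Qed.

Definition fst_marg (T X Y : C) (h : hom T (X ⊗ Y)) : hom T X :=
  runit X ∘ (idm X ⊠ del Y) ∘ h.
Definition snd_marg (T X Y : C) (h : hom T (X ⊗ Y)) : hom T Y :=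
  lunit Y ∘ (del X ⊠ idm Y) ∘ h.

Lemma proj_pair (X Y : C) :
  ((runit X ∘ (idm X ⊠ del Y)) ⊠ (lunit Y ∘ (del X ⊠ idm Y))) ∘ copy (X ⊗ Y)
  = idm _.
Proof.
rewrite tensmM -compmA copy_tens (compmA (_ ⊠ (_ ⊠ _))) -swap_mid_nat.
rewrite swap_mid_munit comp1m -!tensmM !compmA.
by rewrite copy_delr copy_dell tensm1.
Qed.

Lemma copyable_pair (T X Y : C) (h : hom T (X ⊗ Y)) : copyable h ->
  (fst_marg h ⊠ snd_marg h) ∘ copy T = h.
Proof.
by move=> hc; rewrite /fst_marg /snd_marg tensmM -compmA -hc compmA proj_pair comp1m.
Qed.

Lemma fst_marg_comp (T X X' Y Y' : C) (f : hom X X') (g : hom Y Y')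
    (h : hom T (X ⊗ Y)) :
  is_total g -> fst_marg ((f ⊠ g) ∘ h) = f ∘ fst_marg h.
Proof.
move=> gt; rewrite /fst_marg !compmA -(compmA (runit _)) -tensmM gt comp1m.
by rewrite -runit_nat -(compmA _ (f ⊠ idm _)) -tensmM compm1 comp1m.
Qed.

Lemma snd_marg_comp (T X X' Y Y' : C) (f : hom X X') (g : hom Y Y')
    (h : hom T (X ⊗ Y)) :
  is_total f -> snd_marg ((f ⊠ g) ∘ h) = g ∘ snd_marg h.
Proof.
move=> ft; rewrite /snd_marg !compmA -(compmA (lunit _)) -tensmM ft comp1m.
by rewrite -lunit_nat -(compmA _ (idm _ ⊠ g)) -tensmM compm1 comp1m.
Qed.

Lemma deterministic_tens (X X' Y Y' : C) (f : hom X X') (g : hom Y Y') :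
  deterministic f -> deterministic g -> deterministic (f ⊠ g).
Proof.
move=> [ft fc] [gt gc]; split; rewrite /is_total /copyable.
  by rewrite !del_tens -compmA -tensmM ft gt.
rewrite !copy_tens -compmA -tensmM fc gc tensmM compmA swap_mid_nat.
by rewrite -compmA.
Qed.

End CDFacts.

Section Partial.
Variables (C : markovcat) (hC : partializable C).

Lemma det_mono_tens (X X' Y Y' : C) (i : hom X X') (j : hom Y Y') :
  det_mono i -> det_mono j -> det_mono (i ⊠ j).
Proof.
move=> hi hj; split; first exact: deterministic_tens hi.1 hj.1.
have -> : i ⊠ j = braid _ _ ∘ (j ⊠ idm _) ∘ (braid _ _ ∘ (i ⊠ idm _)).
  rewrite (braid_nat j (idm _)) compmA -(compmA _ (braid _ _) (braid _ _)) braidK compm1.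
  by rewrite -tensmM comp1m compm1.
have bm (U V : C) : monic (braid U V).
  move=> T a b /(congr1 (compm (braid _ _))).
  by rewrite !compmA braidK !comp1m.
by do ![apply: monic_comp => //]; apply: pz_tens_monic.
Qed.

Lemma pullback_tens (X Y D P X' Y' D' P' : C)
    (f : hom X Y) (i : hom D Y) (p : hom P X) (q : hom P D)
    (f' : hom X' Y') (i' : hom D' Y') (p' : hom P' X') (q' : hom P' D') :
  det_mono i -> det_mono i' ->
  is_pullback f i p q -> is_pullback f' i' p' q' ->
  is_pullback (f ⊠ f') (i ⊠ i') (p ⊠ p') (q ⊠ q').
Proof.
move=> di di' pb pb'; have [e u] := pb; have [e' u'] := pb'.
have dii := det_mono_tens di di'.
have dpp : det_mono (p ⊠ p').
  by apply: det_mono_tens; [apply: pz_pullback_det pb | apply: pz_pullback_det pb'].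
split=> [|T a b eab]; first by rewrite -!tensmM e e'.
have [Q [r [s pbQ]]] := pz_pullback hC (f ⊠ f') dii.
have [er ur] := pbQ.
have [[_ rc] _] := pz_pullback_det hC dii pbQ.
have [t [[ta _] _]] := ur _ _ _ eab.
have [c1 [[c1p _] _]] : exists! c, p ∘ c = fst_marg r /\ q ∘ c = fst_marg s.
  apply: u; rewrite -(fst_marg_comp _ _ (all_total f')) er.
  by rewrite fst_marg_comp //; exact: all_total.
have [c2 [[c2p _] _]] : exists! c, p' ∘ c = snd_marg r /\ q' ∘ c = snd_marg s.
  apply: u'; rewrite -(snd_marg_comp _ _ (all_total f)) er.
  by rewrite snd_marg_comp //; exact: all_total.
pose c := (c1 ⊠ c2) ∘ copy Q ∘ t.
have pc : (p ⊠ p') ∘ c = a.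
  by rewrite /c !compmA -tensmM c1p c2p copyable_pair.
exists c; split=> [|d [pd _]]; last by apply: dpp.2; rewrite pc pd.
by split=> //; apply: dii.2; rewrite -eab -pc !compmA -!tensmM e e'.
Qed.

Structure span (X Y : C) := Span {
  apex : C;
  lleg : hom apex X;
  rleg : hom apex Y;
  lleg_det_mono : det_mono lleg
}.

Definition span_iso (X Y : C) (s s' : span X Y) : Prop :=
  exists t : hom (apex s) (apex s'),
    is_iso t /\ lleg s' ∘ t = lleg s /\ rleg s' ∘ t = rleg s.

Lemma span_iso_refl (X Y : C) (s : span X Y) : span_iso s s.
Proof.
by exists (idm _); rewrite !compm1; split=> //; exact: is_iso_id.
Qed.

Lemma span_iso_sym (X Y : C) (s s' : span X Y) : span_iso s s' -> span_iso s' s.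
Proof.
move=> [t [[r [rt tr]] [el er]]]; exists r; split; first by exists t.
by rewrite -el -er -!compmA tr !compm1.
Qed.

Lemma span_iso_trans (X Y : C) (s2 s1 s3 : span X Y) :
  span_iso s1 s2 -> span_iso s2 s3 -> span_iso s1 s3.
Proof.
move=> [t [[r [rt tr]] [el er]]] [t' [[r' [rt' tr']] [el' er']]].
exists (t' ∘ t); rewrite !compmA el' er'; split=> //; exists (r ∘ r'); split.
  by rewrite compmA -(compmA r) rt' compm1.
by rewrite compmA -(compmA t') tr compm1.
Qed.

Definition span_rel (X Y : C) : rel {classic span X Y} :=
  fun s s' => `[< span_iso s s' >].

Lemma span_rel_refl (X Y : C) : reflexive (@span_rel X Y).
Proof. by move=> s; apply/asboolP/span_iso_refl. Qed.

Lemma span_rel_sym (X Y : C) : symmetric (@span_rel X Y).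
Proof. by move=> s s'; apply/asboolP/asboolP; apply: span_iso_sym. Qed.

Lemma span_rel_trans (X Y : C) : transitive (@span_rel X Y).
Proof.
by move=> s2 s1 s3 /asboolP h /asboolP h'; apply/asboolP/(span_iso_trans h).
Qed.

Canonical span_equiv (X Y : C) :=
  EquivRel (@span_rel X Y) (@span_rel_refl X Y) (@span_rel_sym X Y)
    (@span_rel_trans X Y).

Definition partial_hom (X Y : C) : Type := {eq_quot @span_equiv X Y}.

Definition span_class (X Y : C) (s : span X Y) : partial_hom X Y :=
  \pi_({eq_quot @span_equiv X Y}) s.

Definition pspan (X Y D : C) (i : hom D X) (di : det_mono i) (f : hom D Y) :
  partial_hom X Y := span_class (Span f di).

Lemma span_classP (X Y : C) (s s' : span X Y) :
  span_class s = span_class s' <-> span_iso s s'.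
Proof. by split=> [/eqmodP/asboolP|h]; last by apply/eqmodP/asboolP. Qed.

Definition span_repr (X Y : C) (u : partial_hom X Y) : span X Y :=
  repr (u : {eq_quot @span_equiv X Y}).

Lemma span_reprK (X Y : C) (u : partial_hom X Y) : span_class (span_repr u) = u.
Proof. exact: (@reprK _ {eq_quot @span_equiv X Y}). Qed.

Lemma partial_homP (X Y : C) (u : partial_hom X Y) :
  exists (D : C) (i : hom D X) (di : det_mono i) (f : hom D Y), u = pspan di f.
Proof.
rewrite -(span_reprK u); case: (span_repr u) => D i f di.
by exists D, i, di, f.
Qed.

Lemma pspan_eq (X Y D D' : C) (i : hom D X) (di : det_mono i) (f : hom D Y)
    (i' : hom D' X) (di' : det_mono i') (f' : hom D' Y) (t : hom D D') :
  is_iso t -> i' ∘ t = i -> f' ∘ t = f -> pspan di f = pspan di' f'.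
Proof. by move=> ti ei ef; apply/span_classP; exists t. Qed.

Lemma span_comp_ex (X Y Z : C) (s : span X Y) (s' : span Y Z) :
  { w : { P : C & (hom P (apex s) * hom P (apex s'))%type }
  | is_pullback (rleg s) (lleg s') (projT2 w).1 (projT2 w).2 }.
Proof.
apply: cid; have [P [p [q pb]]] := pz_pullback hC (rleg s) (lleg_det_mono s').
by exists (existT _ P (p, q)).
Qed.

(* The pullback is a chosen one; by [partial_compE] below, the class of the
   composite can be computed with any pullback and any representatives. *)
Definition span_comp (X Y Z : C) (s : span X Y) (s' : span Y Z) : span X Z :=
  let: exist w pb := span_comp_ex s s' in
  Span (rleg s' ∘ (projT2 w).2)
    (det_mono_comp (lleg_det_mono s)
      (pz_pullback_det hC (lleg_det_mono s') pb)).

(* Here and for the tensor product, [span_repr] is a chosen representative;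
   independence of it is [partial_compE] and [partial_tensE]. *)
Definition partial_comp (X Y Z : C) (v : partial_hom Y Z) (u : partial_hom X Y) :
  partial_hom X Z := span_class (span_comp (span_repr u) (span_repr v)).

Definition span_tens (X X' Y Y' : C) (s : span X X') (s' : span Y Y') :
    span (X ⊗ Y) (X' ⊗ Y') :=
  Span (rleg s ⊠ rleg s') (det_mono_tens (lleg_det_mono s) (lleg_det_mono s')).

Definition partial_tens (X X' Y Y' : C) (u : partial_hom X X')
    (v : partial_hom Y Y') : partial_hom (X ⊗ Y) (X' ⊗ Y') :=
  span_class (span_tens (span_repr u) (span_repr v)).

Definition partial_incl (X Y : C) (f : hom X Y) : partial_hom X Y :=
  pspan (det_mono_id X) f.

Lemma partial_compE (X Y Z A B P : C)
    (i : hom A X) (di : det_mono i) (f : hom A Y)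
    (j : hom B Y) (dj : det_mono j) (g : hom B Z)
    (p : hom P A) (q : hom P B) (dip : det_mono (i ∘ p)) :
  is_pullback f j p q ->
  partial_comp (pspan dj g) (pspan di f) = pspan dip (g ∘ q).
Proof.
move=> pb; apply/span_classP; rewrite /span_comp.
case: span_comp_ex => -[Q [r s]] /= pbQ.
have /span_classP[t [ti [et ft]]] := span_reprK (pspan di f).
have /span_classP[k [ki [ek fk]]] := span_reprK (pspan dj g).
have /= [t' [t't tt']] := ti.
have /= [k' [k'k kk']] := ki.
rewrite /= in ti et ft ki ek fk.
have pbQ' : is_pullback f j (t ∘ r) (k ∘ s).
  split=> [|T a b eab]; first by rewrite !compmA ft ek pbQ.1.
  have [|c [[c1 c2] _]] := pbQ.2 _ (t' ∘ a) (k' ∘ b).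
    by rewrite -ft -ek !compmA -(compmA _ t) tt' compm1 -(compmA _ k) kk' compm1.
  exists c; split.
    by rewrite -!compmA c1 c2 !compmA tt' kk' !comp1m.
  move=> d [d1 d2]; apply: (pullback_eq pbQ).
    by rewrite c1 -d1 !compmA t't comp1m.
  by rewrite c2 -d2 !compmA k'k comp1m.
have [c [ci [c1 c2]]] := pullback_uniq pbQ' pb.
exists c; split=> //=; split.
  by rewrite -compmA c1 compmA et.
by rewrite -compmA c2 compmA fk.
Qed.

Lemma partial_tensE (X X' Y Y' A B : C)
    (i : hom A X) (di : det_mono i) (f : hom A X')
    (j : hom B Y) (dj : det_mono j) (g : hom B Y')
    (dij : det_mono (i ⊠ j)) :
  partial_tens (pspan di f) (pspan dj g) = pspan dij (f ⊠ g).
Proof.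
apply/span_classP.
have /span_classP[t [/= [t' [t't tt']] [et ft]]] := span_reprK (pspan di f).
have /span_classP[k [/= [k' [k'k kk']] [ek fk]]] := span_reprK (pspan dj g).
rewrite /= in et ft ek fk.
exists (t ⊠ k); split; first by exists (t' ⊠ k');
  rewrite -!tensmM t't k'k tt' kk' !tensm1.
by rewrite /= -!tensmM et ek ft fk.
Qed.

Lemma partial_incl_compr (X Y Z D : C) (i : hom D X) (di : det_mono i)
    (f : hom D Y) (g : hom Y Z) :
  partial_comp (partial_incl g) (pspan di f) = pspan di (g ∘ f).
Proof.
have d1 : det_mono (i ∘ idm D) by rewrite compm1.
rewrite (partial_compE (q := f) _ _ _ d1); last exact: pullback_id.
by apply: (pspan_eq _ _ (is_iso_id _)); rewrite ?compm1 //.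
Qed.

Lemma partial_incl_compl (X Y Z D P : C) (h : hom X Y) (i : hom D Y)
    (di : det_mono i) (f : hom D Z) (p : hom P X) (dp : det_mono p)
    (q : hom P D) :
  is_pullback h i p q ->
  partial_comp (pspan di f) (partial_incl h) = pspan dp (f ∘ q).
Proof.
move=> pb; have d1 : det_mono (idm X ∘ p) by rewrite comp1m.
rewrite (partial_compE _ _ _ d1 pb).
by apply: (pspan_eq _ _ (is_iso_id _)); rewrite ?comp1m ?compm1 //.
Qed.

Lemma partial_inclM (X Y Z : C) (g : hom Y Z) (f : hom X Y) :
  partial_incl (g ∘ f) = partial_comp (partial_incl g) (partial_incl f).
Proof. by rewrite [RHS]partial_incl_compr. Qed.

Lemma partial_inclT (X X' Y Y' : C) (f : hom X X') (g : hom Y Y') :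
  partial_tens (partial_incl f) (partial_incl g) = partial_incl (f ⊠ g).
Proof.
have d1 : det_mono (idm X ⊠ idm Y) by rewrite tensm1; exact: det_mono_id.
rewrite (partial_tensE _ _ _ _ d1).
apply: (pspan_eq _ _ (is_iso_id _)); rewrite ?comp1m ?compm1 ?tensm1 //.
Qed.

Lemma partial_comp1m (X Y : C) (u : partial_hom X Y) :
  partial_comp (partial_incl (idm Y)) u = u.
Proof.
have [D [i [di [f ->]]]] := partial_homP u.
by rewrite partial_incl_compr comp1m.
Qed.

Lemma partial_compm1 (X Y : C) (u : partial_hom X Y) :
  partial_comp u (partial_incl (idm X)) = u.
Proof.
have [D [i [di [f ->]]]] := partial_homP u.
rewrite (partial_incl_compl (p := i) (q := idm D) _ _ di) ?compm1 //.
exact/pullback_sym/pullback_id.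
Qed.

Lemma partial_compA (X Y Z W : C) (w : partial_hom Z W) (v : partial_hom Y Z)
    (u : partial_hom X Y) :
  partial_comp w (partial_comp v u) = partial_comp (partial_comp w v) u.
Proof.
have [A [i [di [f ->]]]] := partial_homP u.
have [B [j [dj [g ->]]]] := partial_homP v.
have [E [k [dk [h ->]]]] := partial_homP w.
have [P1 [u1 [v1 pb1]]] := pz_pullback hC f dj.
have [P2 [u2 [v2 pb2]]] := pz_pullback hC (g ∘ v1) dk.
have [Q [a [b pbQ]]] := pz_pullback hC g dk.
have du1 := pz_pullback_det hC dj pb1.
have du2 := pz_pullback_det hC dk pb2.
have da := pz_pullback_det hC dk pbQ.
have d1 : det_mono (i ∘ u1) by exact: det_mono_comp.
have d2 : det_mono (i ∘ u1 ∘ u2) by exact: det_mono_comp.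
have d3 : det_mono (j ∘ a) by exact: det_mono_comp.
have d4 : det_mono (i ∘ (u1 ∘ u2)) by rewrite compmA.
have [|d [[ad bd] _]] := pbQ.2 _ (v1 ∘ u2) v2; first by rewrite compmA pb2.1.
have pb3 : is_pullback f (j ∘ a) (u1 ∘ u2) d.
  split=> [|T x y exy]; first by rewrite compmA pb1.1 -!compmA ad.
  have [|c [[c1 c2] _]] := pb1.2 _ x (a ∘ y); first by rewrite compmA.
  have [|c' [[c1' c2'] _]] := pb2.2 _ c (b ∘ y).
    by rewrite -compmA c2 !compmA pbQ.1.
  exists c'; split; first split.
  - by rewrite -compmA c1'.
  - by apply: da.2; rewrite compmA ad -compmA c1'.
  move=> e [e1 _]; apply: (monic_comp du1.2 du2.2).
  by rewrite e1 -compmA c1'.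
rewrite (partial_compE _ _ _ d1 pb1) (partial_compE _ _ _ d2 pb2).
rewrite (partial_compE _ _ _ d3 pbQ) (partial_compE _ _ _ d4 pb3).
apply: (pspan_eq _ _ (is_iso_id _)); rewrite ?compm1 ?compmA //.
by rewrite -compmA bd.
Qed.

Definition partial_cat : category :=
  Category partial_comp1m partial_compm1 partial_compA.

Lemma partial_tensM (X X' X'' Y Y' Y'' : C)
    (f' : partial_hom X' X'') (f : partial_hom X X')
    (g' : partial_hom Y' Y'') (g : partial_hom Y Y') :
  partial_tens (partial_comp f' f) (partial_comp g' g)
  = partial_comp (partial_tens f' g') (partial_tens f g).
Proof.
have [A [i [di [a ->]]]] := partial_homP f.
have [A' [i' [di' [a' ->]]]] := partial_homP f'.
have [B [j [dj [b ->]]]] := partial_homP g.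
have [B' [j' [dj' [b' ->]]]] := partial_homP g'.
have [P [p [q pb]]] := pz_pullback hC a di'.
have [P' [p' [q' pb']]] := pz_pullback hC b dj'.
have dp := pz_pullback_det hC di' pb.
have dp' := pz_pullback_det hC dj' pb'.
have d1 := det_mono_comp di dp.
have d2 := det_mono_comp dj dp'.
have d12 := det_mono_tens d1 d2.
have d3 : det_mono ((i ⊠ j) ∘ (p ⊠ p')) by rewrite -tensmM.
rewrite (partial_compE _ _ _ d1 pb) (partial_compE _ _ _ d2 pb').
rewrite (partial_tensE _ _ _ _ d12) (partial_tensE _ _ _ _ (det_mono_tens di dj)).
rewrite (partial_tensE _ _ _ _ (det_mono_tens di' dj')).
rewrite (partial_compE _ _ _ d3 (pullback_tens di' dj' pb pb')).
apply: (pspan_eq _ _ (is_iso_id _)); rewrite ?compm1 ?tensmM //.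
Qed.

Lemma partial_nat (X X' Y Y' D D' : C)
    (i : hom D X) (di : det_mono i) (f : hom D Y)
    (j : hom D' X') (dj : det_mono j) (g : hom D' Y')
    (hX : hom X X') (hY : hom Y Y') (hD : hom D D') :
  is_iso hX -> is_iso hD -> hX ∘ i = j ∘ hD -> hY ∘ f = g ∘ hD ->
  partial_comp (partial_incl hY) (pspan di f)
  = partial_comp (pspan dj g) (partial_incl hX).
Proof.
move=> iX iD e e'; rewrite partial_incl_compr e'.
by rewrite (partial_incl_compl _ _ di (pullback_iso iX iD e dj.2)).
Qed.

Lemma partial_assoc_nat (X X' Y Y' Z Z' : C) (f : partial_hom X X')
    (g : partial_hom Y Y') (h : partial_hom Z Z') :
  partial_comp (partial_incl (assoc X' Y' Z'))
    (partial_tens (partial_tens f g) h)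
  = partial_comp (partial_tens f (partial_tens g h))
    (partial_incl (assoc X Y Z)).
Proof.
have [A [i [di [a ->]]]] := partial_homP f.
have [B [j [dj [b ->]]]] := partial_homP g.
have [E [k [dk [c ->]]]] := partial_homP h.
have dij := det_mono_tens di dj.
have djk := det_mono_tens dj dk.
rewrite (partial_tensE _ _ _ _ dij) (partial_tensE _ _ _ _ djk).
rewrite (partial_tensE _ _ _ _ (det_mono_tens dij dk)).
rewrite (partial_tensE _ _ _ _ (det_mono_tens di djk)).
by apply: (partial_nat _ _ (assoc_iso _ _ _) (assoc_iso _ _ _)); rewrite assoc_nat.
Qed.

Lemma partial_lunit_nat (X X' : C) (f : partial_hom X X') :
  partial_comp (partial_incl (lunit X'))
    (partial_tens (partial_incl (idm munit)) f)
  = partial_comp f (partial_incl (lunit X)).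
Proof.
have [A [i [di [a ->]]]] := partial_homP f.
rewrite (partial_tensE _ _ _ _ (det_mono_tens (det_mono_id _) di)).
by apply: (partial_nat _ _ (lunit_iso _) (lunit_iso _)); rewrite lunit_nat.
Qed.

Lemma partial_runit_nat (X X' : C) (f : partial_hom X X') :
  partial_comp (partial_incl (runit X'))
    (partial_tens f (partial_incl (idm munit)))
  = partial_comp f (partial_incl (runit X)).
Proof.
have [A [i [di [a ->]]]] := partial_homP f.
rewrite (partial_tensE _ _ _ _ (det_mono_tens di (det_mono_id _))).
by apply: (partial_nat _ _ (runit_iso _) (runit_iso _)); rewrite runit_nat.
Qed.

Lemma partial_braid_nat (X X' Y Y' : C) (f : partial_hom X X')
    (g : partial_hom Y Y') :
  partial_comp (partial_incl (braid X' Y')) (partial_tens f g)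
  = partial_comp (partial_tens g f) (partial_incl (braid X Y)).
Proof.
have [A [i [di [a ->]]]] := partial_homP f.
have [B [j [dj [b ->]]]] := partial_homP g.
rewrite (partial_tensE _ _ _ _ (det_mono_tens di dj)).
rewrite (partial_tensE _ _ _ _ (det_mono_tens dj di)).
by apply: (partial_nat _ _ (braid_iso _ _) (braid_iso _ _)); rewrite braid_nat.
Qed.

Definition partial_symmoncat : symmoncat.
Proof.
refine (@SymMonCat partial_cat (@tens C) (@munit C) partial_tens _
  partial_tensM
  (fun X Y Z => partial_incl (assoc X Y Z))
  (fun X Y Z => partial_incl (assocV X Y Z))
  (fun X => partial_incl (lunit X)) (fun X => partial_incl (lunitV X))
  (fun X => partial_incl (runit X)) (fun X => partial_incl (runitV X))
  (fun X Y => partial_incl (braid X Y)) _ _ _ _ _ _ _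
  partial_assoc_nat partial_lunit_nat partial_runit_nat partial_braid_nat
  _ _ _); rewrite /=; intros; rewrite ?partial_inclT -?partial_inclM.
- by rewrite tensm1.
- by rewrite assocK.
- by rewrite assocVK.
- by rewrite lunitK.
- by rewrite lunitVK.
- by rewrite runitK.
- by rewrite runitVK.
- by rewrite braidK.
- by rewrite pentagon.
- by rewrite triangle.
- by rewrite hexagon.
Defined.

Lemma partial_swap_mid (A B A' B' : C) :
  @swap_mid partial_symmoncat A B A' B' = partial_incl (swap_mid A B A' B').
Proof.
by rewrite /swap_mid /= !partial_inclT -!partial_inclM !partial_inclT -!partial_inclM.
Qed.

Definition partial : cdcat.
Proof.
refine (@CDCat partial_symmoncat
  (fun X : C => partial_incl (copy X)) (fun X : C => partial_incl (del X))
  _ _ _ _ _ _ _ _); intros; rewrite ?partial_swap_mid /=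
  ?partial_inclT -?partial_inclM.
- by rewrite copyA.
- by rewrite copyC.
- by rewrite copy_dell.
- by rewrite copy_delr.
- by rewrite copy_tens.
- by rewrite del_tens.
- by rewrite copy_unit.
- by rewrite del_unit.
Defined.

End Partial.

(* Main.v *)
From mathcomp Require Import all_boot.
Require Import Defs.

(** The domain of the class of a span (D, i, f) first discards the output of f.
    Since f is total, only (D, i, del_D) is left, so everything hinges on the
    composite of copy_X with the span (X ⊗ D, id ⊗ i, id ⊗ del_D), that is, on
    the pullback of id ⊗ i along copy_X. That pullback is D itself, with legs i
    and (i ⊗ id) ∘ copy_D ([copy_pullback]): a map b into X ⊗ D whose image in
    X ⊗ X is a copy of some a has second marginal in D, and this marginal lifts
    a along i. Hence dom u is represented by D with left leg i and right leg
    the first marginal of (i ⊗ id) ∘ copy_D, which is i ([dom_pspan]).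

    The restriction axioms then become statements about spans of the form
    (D, i, i). In each of them the two sides are computed with one and the same
    pullback square, whose commutativity identifies their legs; for (R.1) and
    (R.4) one also needs that pulling a map i ∘ p back along the monomorphism i
    changes nothing ([pullback_monic_factor]). *)

Set Implicit Arguments.
Unset Strict Implicit.
Unset Printing Implicit Defensive.

Local Open Scope cat_scope.

Lemma pullback_monic_factor (C : category) (X D P : C) (i : hom D X)
    (p : hom P D) :
  monic i -> is_pullback (i ∘ p) i (idm P) p.
Proof.
move=> mi; split=> [|T a b]; first by rewrite compm1.
rewrite -compmA => /mi <-; exists a; split; first by rewrite comp1m.
by move=> c [<- _]; rewrite comp1m.
Qed.

Lemma snd_marg_copy (C : cdcat) (T X : C) (a : hom T X) :
  snd_marg (copy X ∘ a) = a.
Proof. by rewrite /snd_marg compmA copy_dell comp1m. Qed.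

Section PartialDomain.
Variables (C : markovcat) (hC : partializable C).

(** Only the existence half needs an argument. The mediating map is the second
    marginal of b; that it induces b may be tested after the monomorphism
    id ⊗ i, where determinism of i turns (i ⊗ i) ∘ copy_D into copy_X ∘ i. *)
Lemma copy_pullback (X D : C) (i : hom D X) : det_mono i ->
  is_pullback (copy X) (idm X ⊠ i) i ((i ⊠ idm D) ∘ copy D).
Proof.
move=> di; have [[_ ic] mi] := di.
have ic' : (idm X ⊠ i) ∘ ((i ⊠ idm D) ∘ copy D) = copy X ∘ i.
  by rewrite compmA -tensmM comp1m compm1.
split=> // T a b eab.
have ia : i ∘ snd_marg b = a.
  by rewrite -(snd_marg_comp _ _ (all_total (idm X))) -eab snd_marg_copy.
exists (snd_marg b); split=> [|c [ci _]]; last by apply: mi; rewrite ia ci.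
split=> //; apply: (det_mono_tens hC (det_mono_id X) di).2.
by rewrite compmA ic' -compmA ia.
Qed.

Lemma pspan_congr (X Y D : C) (i i' : hom D X) (di : det_mono i)
    (di' : det_mono i') (f f' : hom D Y) :
  i = i' -> f = f' -> pspan di f = pspan di' f'.
Proof.
by move=> ei ef; apply: (pspan_eq _ _ (is_iso_id _)); rewrite compm1.
Qed.

Lemma dom_pspan (X Y D : C) (i : hom D X) (di : det_mono i) (f : hom D Y) :
  @dom (partial hC) X Y (pspan di f) = pspan di i.
Proof.
have dXi := det_mono_tens hC (det_mono_id X) di.
rewrite /dom /= (partial_incl_compr hC) (all_total f).
rewrite (partial_tensE hC _ _ _ _ dXi) (partial_incl_compr hC).
rewrite (partial_incl_compl hC dXi _ di (copy_pullback di)).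
apply: pspan_congr => //; rewrite -[LHS]/(fst_marg _).
rewrite (fst_marg_comp _ _ (all_total (idm D))).
by rewrite /fst_marg copy_delr compm1.
Qed.

Lemma pspan_comp (X Y Z A B P : C) (i : hom A X) (di : det_mono i)
    (f : hom A Y) (j : hom B Y) (dj : det_mono j) (g : hom B Z)
    (p : hom P A) (q : hom P B) (pb : is_pullback f j p q) :
  @compm (partial hC) X Y Z (pspan dj g) (pspan di f)
  = pspan (det_mono_comp di (pz_pullback_det hC dj pb)) (g ∘ q).
Proof. exact: partial_compE. Qed.

Lemma dom_restriction :
  @restriction_structure (partial hC) (@dom (partial hC)).
Proof.
split=> [X Y u|X Y Z u v|X Y Z u v|X Y Z u v];
  have [A [i [di [f ->]]]] := partial_homP u.
- rewrite dom_pspan.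
  have := pullback_monic_factor (idm A) di.2; rewrite compm1 => pb.
  by rewrite (pspan_comp _ _ _ pb); apply: pspan_congr; rewrite compm1.
- have [B [j [dj [g ->]]]] := partial_homP v.
  have [P [p [q pb]]] := pz_pullback hC i dj.
  rewrite !dom_pspan (pspan_comp _ _ _ pb) (pspan_comp _ _ _ (pullback_sym pb)).
  by apply: pspan_congr; rewrite pb.1.
- have [B [j [dj [g ->]]]] := partial_homP v.
  have [P [p [q pb]]] := pz_pullback hC i dj.
  rewrite !dom_pspan !(pspan_comp _ _ _ pb) dom_pspan.
  by apply: pspan_congr; rewrite // pb.1.
- have [B [j [dj [g ->]]]] := partial_homP v.
  have [P [p [q pb]]] := pz_pullback hC f dj.
  rewrite !dom_pspan !(pspan_comp _ _ _ pb) dom_pspan.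
  rewrite (pspan_comp _ _ _ (pullback_monic_factor p di.2)).
  by apply: pspan_congr; rewrite ?compm1 // pb.1.
Qed.

End PartialDomain.

Theorem proposition1p6 (C : markovcat) (hC : partializable C) :
  (forall (X Y : C) (u : @hom (partial hC) X Y)
      (D : C) (i : hom D X) (di : det_mono i) (f : hom D Y),
    u = pspan di f -> pspan di i = @dom (partial hC) X Y u)
  /\ @restriction_structure (partial hC)
       (fun X Y (u : @hom (partial hC) X Y) => @dom (partial hC) X Y u).
Proof.
split=> [X Y u D i di f ->|]; first by rewrite dom_pspan.
exact: dom_restriction.
Qed.
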